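(* Let $Y_1,\dots,Y_n$ be i.i.d. real random variables with mean $m$ and finite variance $v$. Assume that $v\le v_0$, where $v_0>0$ is a known (non random) constant. Let $k\ge 1$, let $x_2,\dots,x_k>0$ and $\epsilon_1,\dots,\epsilon_k\in(0,1)$ be constants, and let $U_2,\dots,U_k$ be uniform random variables on $(-1,1)$, independent of each other and of everything else. Define $$\delta_1=\sqrt{\frac{v_0}{2n\epsilon_1}},\qquad \widetilde\theta_1=\frac1n\sum_{i=1}^nY_i,$$ and for $i=2,\dots,k$, $$\gamma_i=\log(1+x_i^{-1}),\qquad \delta_i=\sqrt{\frac{2\bigl[v_0+(1+x_i)^2\delta_{i-1}^2\bigr]\bigl[\log(\epsilon_i^{-1})+\gamma_i\bigr]}{n}},$$ $$\alpha_i=\sqrt{\frac{2\bigl[\log(\epsilon_i^{-1})+\gamma_i\bigr]}{n\bigl[v_0+(1+x_i)^2\delta_{i-1}^2\bigr]}},\qquad \widetilde\theta_i=\widehat\theta_{\alpha_i}\bigl(\widetilde\theta_{i-1}+x_i\delta_{i-1}U_i\bigr).$$ Then with probability at least $1-2\sum_{i=1}^k\epsilon_i$, $$|m-\widetilde\theta_k|\le\delta_k.$$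
   Context: For $\alpha>0$ and $\theta\in\mathbb{R}$, the thresholded estimator based on the sample $Y_1,\dots,Y_n$ is $$\widehat\theta_\alpha(\theta)=\theta+\frac{1}{n\alpha}\sum_{i=1}^nT\bigl[\alpha(Y_i-\theta)\bigr],\qquad T(x)=\frac12\log\left(\frac{1+x+\frac{x^2}{2}}{1-x+\frac{x^2}{2}}\right).$$ The same sample is used at every step of the iteration. *)

(* Defs.v *)
From HB Require Import structures.
From mathcomp Require Import all_boot all_order all_algebra.
From mathcomp Require Import all_classical all_reals all_analysis.

Set Implicit Arguments.
Unset Strict Implicit.
Unset Printing Implicit Defensive.

Import Order.TTheory GRing.Theory Num.Theory.
Import numFieldNormedType.Exports.

Local Open Scope classical_set_scope.
Local Open Scope ring_scope.

Definition mutually_independent (d : measure_display) (T : measurableType d)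
    (R : realType) (P : probability T R) (I : finType)
    (X : I -> {RV P >-> R}) : Prop :=
  forall (J : {set I}) (A : I -> set R),
    (forall i, i \in J -> measurable (A i)) ->
    P (\bigcap_(i in [set` J]) (X i @^-1` A i)) =
    (\prod_(i in J) P (X i @^-1` A i))%E.

Definition same_law (d : measure_display) (T : measurableType d)
    (R : realType) (P : probability T R) (X Y : {RV P >-> R}) : Prop :=
  forall A : set R, measurable A -> distribution P X A = distribution P Y A.

Lemma ltrN11 (R : realType) : (-1 : R) < 1.
Proof. by apply: (@lt_trans _ _ 0); rewrite ?ltrN10 ?ltr01. Qed.

(* [uniform_prob] has its density on the closed interval; the endpoints are
   Lebesgue-null, so this is the uniform law on (-1, 1). *)
Definition uniform_N11 (d : measure_display) (T : measurableType d)
    (R : realType) (P : probability T R) (X : {RV P >-> R}) : Prop :=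
  forall A : set R, measurable A ->
    distribution P X A = uniform_prob (ltrN11 R) A.

Definition influence (R : realType) (x : R) : R :=
  2^-1 * ln ((1 + x + x ^+ 2 / 2) / (1 - x + x ^+ 2 / 2)).

Definition theta_hat (R : realType) (n : nat) (y : 'I_n -> R)
    (alpha theta : R) : R :=
  theta + (n%:R * alpha)^-1 * \sum_(i < n) influence (alpha * (y i - theta)).

Definition gamma_ (R : realType) (x : nat -> R) (i : nat) : R :=
  ln (1 + (x i)^-1).

(* Indices start at 1; the values at index 0 of [delta_] and [theta_] are
   never used. *)
Fixpoint delta_ (R : realType) (n : nat) (v0 : R) (x eps : nat -> R)
    (i : nat) : R :=
  match i with
  | 0 => 0
  | 1 => Num.sqrt (v0 / (2 * n%:R * eps 1%N))
  | j.+1 =>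
      Num.sqrt (2 * (v0 + (1 + x i) ^+ 2 * delta_ n v0 x eps j ^+ 2)
                  * (ln (eps i)^-1 + gamma_ x i) / n%:R)
  end.

Definition alpha_ (R : realType) (n : nat) (v0 : R) (x eps : nat -> R)
    (i : nat) : R :=
  Num.sqrt (2 * (ln (eps i)^-1 + gamma_ x i)
            / (n%:R * (v0 + (1 + x i) ^+ 2 * delta_ n v0 x eps i.-1 ^+ 2))).

(* [y] is the realized sample, [u] the realized auxiliary uniform variables *)
Fixpoint theta_ (R : realType) (n : nat) (v0 : R) (x eps : nat -> R)
    (y : 'I_n -> R) (u : nat -> R) (i : nat) : R :=
  match i with
  | 0 => 0
  | 1 => n%:R^-1 * \sum_(l < n) y l
  | j.+1 =>
      theta_hat y (alpha_ n v0 x eps i)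
        (theta_ v0 x eps y u j + x i * delta_ n v0 x eps j * u i)
  end.

(* The variables Y_1, ..., Y_n, U_2, ..., U_k as a single family; the index
   [inr j], j < k - 1, stands for U_(j + 2). *)
Definition sample_and_uniforms (d : measure_display) (T : measurableType d)
    (R : realType) (P : probability T R) (n k : nat)
    (Y : 'I_n -> {RV P >-> R}) (U : nat -> {RV P >-> R})
    (s : 'I_n + 'I_k.-1) : {RV P >-> R} :=
  match s with
  | inl i => Y i
  | inr j => U j.+2
  end.

(* Main.v *)
Require Import Defs.
From HB Require Import structures.
From mathcomp Require Import all_boot all_order all_algebra.
From mathcomp Require Import all_classical all_reals all_analysis.
From mathcomp Require Import measurable_realfun ring lra.

Set Implicit Arguments.
Unset Strict Implicit.
Unset Printing Implicit Defensive.

Import Order.TTheory GRing.Theory Num.Theory.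
Import numFieldNormedType.Exports.

Local Open Scope classical_set_scope.
Local Open Scope ring_scope.

(** Why the bound holds. The proof is an induction on the number of steps: each
    step i costs a probability of at most 2 eps_i.

    The first estimate is the empirical mean, and the claim for it is
    Chebyshev's inequality ([chebyshev_mean]).

    For a later step, write theta for the previous estimate, D for its
    confidence radius, and s = x D. The thresholded estimator is recomputed from
    the same sample at theta + s U, so its centre depends on the data and a
    deviation bound for a fixed centre does not apply. The perturbation U
    repairs this. For a fixed centre h and a real a, the exponential score

      W_a(h) = exp (sum_i T(a (Y_i - h))
                    - n (a (m - h) + a^2 / 2 (v0 + (m - h)^2)))

    has expectation at most 1 ([integral_exp_score_le1]), because
    exp (T z) <= 1 + z + z^2 / 2 and the sample is independent. When
    |m - theta| <= D, the random centre theta + s U is, conditionally on the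
    past, uniform on an interval of length 2 s inside [m - (D + s), m + (D + s)],
    so that averaging a nonnegative function over it costs at most a factor
    (D + s) / s with respect to averaging over the larger interval, which does
    not depend on the data. By Tonelli the expectation of the score at the
    random centre, on that event, is at most (D + s) / s = 1 + 1 / x. A deviation
    of the new estimate by more than delta, to the right or to the left, forces
    the score at a = alpha or at a = - alpha to be at least
    exp (n (alpha delta - alpha^2 / 2 (v0 + (D + s)^2))), so Markov's inequality
    bounds its probability ([perturbed_deviation_le]). The levels alpha_i and
    delta_i make this exponent equal to log (1 / eps_i) + log (1 + 1 / x_i)
    ([step_exponentE]): the second logarithm pays for the factor 1 + 1 / x_i, and
    each side costs eps_i ([step_riskE]).

    The independence of U_i from the past is used through the sigma-algebra
    generated by the variables already seen ([past_independent]): T with this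
    sigma-algebra is the measurable space carrying the previous estimate, and
    the joint law of the past and U_i is a product law. *)

(** * Independence and product laws *)

Definition independent_pair d d1 d2 (T : measurableType d)
    (T1 : measurableType d1) (T2 : measurableType d2) (R : realType)
    (P : probability T R) (Z : T -> T1) (X : T -> T2) :=
  forall A B, measurable A -> measurable B ->
    (P (Z @^-1` A `&` X @^-1` B) = P (Z @^-1` A) * P (X @^-1` B))%E.

Section independent_pair.
Local Open Scope ereal_scope.
Context d d1 d2 (T : measurableType d) (T1 : measurableType d1)
  (T2 : measurableType d2) (R : realType) (P : probability T R).
Variables (Z : {mfun T >-> T1}) (X : {mfun T >-> T2}).
Hypothesis ZX : independent_pair P Z X.

Definition joint (t : T) := (Z t, X t).

Lemma measurable_joint : measurable_fun setT joint.
Proof. by apply/measurable_fun_pair. Qed.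

HB.instance Definition _ :=
  isMeasurableFun.Build _ _ _ _ joint measurable_joint.

Lemma joint_distributionE (A : set (T1 * T2)) : measurable A ->
  (distribution P Z \x distribution P X) A =
  distribution P joint A.
Proof. by move=> mA; exact: product_measure_unique. Qed.

Lemma ge0_integral_joint (f : T1 * T2 -> \bar R) :
  measurable_fun [set: T1 * T2] f -> (forall p, 0 <= f p) ->
  \int[P]_t f (Z t, X t) =
  \int[distribution P Z]_z \int[distribution P X]_x f (z, x).
Proof.
move=> mf f0.
transitivity (\int[distribution P joint]_p f p).
  by rewrite ge0_integral_pushforward//; exact: measurable_joint.
rewrite -fubini_tonelli1//; apply/esym; apply: eq_measure_integral => A mA _.
exact: joint_distributionE.
Qed.

Lemma integral_joint (f : T1 * T2 -> \bar R) :
  measurable_fun [set: T1 * T2] f -> P.-integrable setT (fun t => f (Z t, X t)) ->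
  \int[P]_t f (Z t, X t) =
  \int[distribution P Z]_z \int[distribution P X]_x f (z, x).
Proof.
move=> mf intf.
have pf : (distribution P Z \x distribution P X).-integrable setT f.
  apply/integrable12ltyP => //.
  rewrite -(ge0_integral_joint (f := fun p => `|f p|))//; last first.
    exact: measurableT_comp.
  by move/integrableP : intf => [].
transitivity (\int[distribution P joint]_p f p).
  by rewrite integral_pushforward//; exact: measurable_joint.
apply/esym; rewrite integral12_prod_meas1//; apply: eq_measure_integral => A mA _.
exact: joint_distributionE.
Qed.

Lemma ge0_integral_mul_independent (f : T1 -> R) (g : T2 -> R) :
  measurable_fun setT f -> measurable_fun setT g ->
  (forall z, 0 <= f z)%R -> (forall x, 0 <= g x)%R ->
  \int[P]_t (f (Z t) * g (X t))%:E =
  \int[P]_t (f (Z t))%:E * \int[P]_t (g (X t))%:E.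
Proof.
move=> mf mg f0 g0.
have mh : measurable_fun [set: T1 * T2] (fun p => (f p.1 * g p.2)%:E).
  by apply/measurable_EFinP; apply: measurable_funM; exact: measurableT_comp.
rewrite (ge0_integral_joint mh); last by move=> p; rewrite lee_fin mulr_ge0.
have mfE : measurable_fun setT (EFin \o f) by exact/measurable_EFinP.
have mgE : measurable_fun setT (EFin \o g) by exact/measurable_EFinP.
have -> : \int[P]_t (f (Z t))%:E = \int[distribution P Z]_z (f z)%:E.
  by rewrite (ge0_integral_distribution _ mfE).
have -> : \int[P]_t (g (X t))%:E = \int[distribution P X]_x (g x)%:E.
  by rewrite (ge0_integral_distribution _ mgE).
rewrite -ge0_integralZr//; [|by move=> z _; rewrite lee_fin|].
  apply: eq_integral => z _ /=; under eq_integral do rewrite EFinM.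
  by rewrite ge0_integralZl//= => [x _|]; rewrite lee_fin.
by apply: integral_ge0 => x _; rewrite lee_fin.
Qed.

Lemma integral_mul_independent (f : T1 -> R) (g : T2 -> R) :
  measurable_fun setT f -> measurable_fun setT g ->
  P.-integrable setT (fun t => (f (Z t))%:E) ->
  P.-integrable setT (fun t => (g (X t))%:E) ->
  P.-integrable setT (fun t => (f (Z t) * g (X t))%:E) ->
  \int[P]_t (f (Z t) * g (X t))%:E =
  \int[P]_t (f (Z t))%:E * \int[P]_t (g (X t))%:E.
Proof.
move=> mf mg intf intg intfg.
have mh : measurable_fun [set: T1 * T2] (fun p => (f p.1 * g p.2)%:E).
  by apply/measurable_EFinP; apply: measurable_funM; exact: measurableT_comp.
rewrite (integral_joint mh)//=.
have mfE : measurable_fun setT (EFin \o f) by exact/measurable_EFinP.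
have mgE : measurable_fun setT (EFin \o g) by exact/measurable_EFinP.
have intfZ : (distribution P Z).-integrable setT (EFin \o f).
  exact: integrable_pushforward.
have intgX : (distribution P X).-integrable setT (EFin \o g).
  exact: integrable_pushforward.
have -> : \int[P]_t (f (Z t))%:E = \int[distribution P Z]_z (f z)%:E.
  by rewrite (integral_distribution mfE).
have -> : \int[P]_t (g (X t))%:E = \int[distribution P X]_x (g x)%:E.
  by rewrite (integral_distribution mgE).
have gfin : \int[distribution P X]_x (g x)%:E \is a fin_num.
  exact: integrable_fin_num.
rewrite -(fineK gfin) -integralZr//; apply: eq_integral => z _.
under eq_integral do rewrite EFinM.
by rewrite integralZl// fineK.
Qed.

End independent_pair.

Section cylinders.
Context d (T : measurableType d) (R : realType) (P : probability T R)
  (I : finType) (X : I -> {RV P >-> R}).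
Implicit Type J : {set I}.

Definition cylinder J : set (set T) :=
  [set C | exists2 A : I -> set R, (forall i, measurable (A i)) &
     C = \bigcap_(i in [set` J]) (X i @^-1` A i)].

(** The sample space with what the variables indexed by [J] reveal. *)
Definition past J : measurableType _ := g_sigma_algebraType (cylinder J).

Lemma cylinder_setI_closed J : setI_closed (cylinder J).
Proof.
move=> _ _ [A mA ->] [B mB ->]; exists (fun i => A i `&` B i).
  by move=> i; exact: measurableI.
by rewrite -bigcapI; apply: eq_bigcapr => i _; rewrite preimage_setI.
Qed.

Lemma cylinder_measurable J : cylinder J `<=` measurable.
Proof.
move=> _ [A mA ->]; apply: fin_bigcap_measurable; first exact: finite_finset.
by move=> i _; rewrite -[X in measurable X]setTI; exact: measurable_funP.
Qed.

Lemma past_measurable J (A : set T) :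
  measurable (A : set (past J)) -> measurable A.
Proof.
by apply: smallest_sub; [exact: sigma_algebra_measurable|
  exact: cylinder_measurable].
Qed.

Definition to_past J : T -> past J := id.

Lemma measurable_to_past J : measurable_fun setT (to_past J).
Proof. by move=> _ A mA; rewrite setTI; exact: past_measurable mA. Qed.

HB.instance Definition _ J := isMeasurableFun.Build _ _ _ _
  (to_past J) (@measurable_to_past J).

Lemma measurable_past J (i : I) : i \in J ->
  measurable_fun (setT : set (past J)) (X i : past J -> R).
Proof.
move=> iJ _ B mB; rewrite setTI; apply: sub_sigma_algebra.
exists (fun j => if j == i then B else setT).
  by move=> j; case: ifP.
apply/seteqP; split => [t Bt j _ /=|t /(_ i iJ)/=]; last by rewrite eqxx.
by case: eqP => // ->.
Qed.

Hypothesis indepX : mutually_independent X.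

(** Mutual independence gives the product rule on cylinders only. They form a
    pi-system generating the past, and two finite measures that agree on it
    agree on the sigma-algebra. *)
Lemma past_independent J (i : I) : i \notin J ->
  independent_pair P (to_past J) (X i).
Proof.
move=> iJ A B mA mB; rewrite [to_past J @^-1` A]preimage_id.
have mXB : measurable (X i @^-1` B).
  by rewrite -[X in measurable X]setTI; exact: measurable_funP.
pose p : {nonneg R} := NngNum (fine_ge0 (measure_ge0 P (X i @^-1` B))).
have pE : p%:num%:E = P (X i @^-1` B) by rewrite fineK ?fin_num_measure.
transitivity (mscale p P A); last by rewrite /mscale pE muleC.
rewrite -[LHS]/(mrestr P mXB A).
apply: (g_sigma_algebra_measure_unique (cylinder J) _ (fun=> setT)) => //.
- exact: cylinder_measurable.
- by move=> _; exists (fun=> setT) => //; apply/seteqP; split.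
- by rewrite bigcup_const.
- exact: cylinder_setI_closed.
- move=> _ [C mC ->].
  rewrite -[LHS]/(P (_ `&` _)) -[RHS]/(p%:num%:E * P _)%E pE.
  pose C' j := if j == i then B else C j.
  have C'J j : j \in J -> C' j = C j.
    by rewrite /C'; case: eqP => // -> iJ'; rewrite iJ' in iJ.
  have := @indepX (i |: J) C'.
  have C'i : C' i = B by rewrite /C' eqxx.
  rewrite big_setU1//= C'i => h.
  transitivity (P (\bigcap_(j in [set` (i |: J)%SET]) (X j @^-1` C' j))).
    congr (P _); apply/seteqP; split => [t [Ct Bt] j|t Ct].
      rewrite /= in_setU1 => /orP[/eqP ->|jJ]; first by rewrite C'i.
      by rewrite /= C'J//; exact: Ct.
    split => [j jJ|].
      by have := Ct j; rewrite /= C'J//; apply; rewrite in_setU1 jJ orbT.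
    by have := Ct i; rewrite /= C'i; apply; rewrite setU11.
  rewrite h; last by move=> j _; rewrite /C'; case: ifP.
  rewrite [in RHS]indepX//; congr (_ * _)%E.
  by apply: eq_bigr => j jJ; rewrite C'J.
- move=> _; rewrite -[X in (X < _)%E]/(P (_ `&` _)).
  by rewrite (le_lt_trans (probability_le1 _ _)) ?ltry//; exact: measurableI.
Qed.

(** Peeling off one factor at a time: the product of the others is measurable
    for their past. *)
Lemma ge0_integral_prod_independent (s : seq I) (f : I -> R -> R) :
  uniq s -> (forall i, measurable_fun setT (f i)) -> (forall i r, 0 <= f i r) ->
  (\int[P]_t (\prod_(i <- s) f i (X i t))%:E =
   \prod_(i <- s) \int[P]_t (f i (X i t))%:E)%E.
Proof.
move=> + mf f0; elim: s => [|i s IH] /=.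
  move=> _; under eq_integral do rewrite big_nil.
  by rewrite big_nil integral_cst//= mul1e probability_setT.
move=> /andP[si us]; under eq_integral do rewrite big_cons.
rewrite big_cons -IH//.
pose J := [set j in s].
have iJ : i \notin J by rewrite inE.
pose g (z : past J) := \prod_(j <- s) f j (X j z).
have mg : measurable_fun setT g.
  rewrite /g; apply: measurable_prod => j js; apply: measurableT_comp => //.
  by apply: measurable_past; rewrite inE.
have g0 z : 0 <= g z by exact: prodr_ge0.
rewrite muleC.
rewrite -(ge0_integral_mul_independent (past_independent iJ) mg (mf i))//.
by apply: eq_integral => t _; rewrite mulrC.
Qed.
End cylinders.

(** The events not indexed by the image of [f] are completed by the sure
    event. *)
Lemma mutually_independent_comp d (T : measurableType d) (R : realType)
    (P : probability T R) (I I' : finType) (X : I -> {RV P >-> R})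
    (f : I' -> I) :
  injective f -> mutually_independent X ->
  mutually_independent (fun i => X (f i)).
Proof.
move=> finj indepX J A mA.
pose A' i := if [pick j | f j == i] is Some j then A j else setT.
have A'f j : A' (f j) = A j.
  rewrite /A'; case: pickP => [j' /eqP/finj -> //|/(_ j)].
  by rewrite eqxx.
have := indepX (f @: J) A'; rewrite big_imset/=; last by move=> ? ? _ _ /finj.
under eq_bigr do rewrite A'f.
move=> <-; last first.
  by move=> _ /imsetP[j jJ ->]; rewrite A'f; exact: mA.
congr (P _); apply/seteqP; split => t Ct.
  by move=> _ /imsetP[j jJ ->]/=; rewrite A'f; exact: Ct.
by move=> j jJ; have := Ct (f j); rewrite /= A'f; apply; exact: imset_f.
Qed.

(** * Measurability of comparisons *)

Section measurable_comparison.
Context d (T : measurableType d) (R : realType).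

Lemma measurable_ltr_set (f g : T -> R) :
  measurable_fun setT f -> measurable_fun setT g ->
  measurable [set t | f t < g t].
Proof.
move=> mf mg.
have H := measurable_fun_ltr mf mg measurableT.
by have := H [set true] I; rewrite setTI preimage_true.
Qed.

Lemma measurable_ler_set (f g : T -> R) :
  measurable_fun setT f -> measurable_fun setT g ->
  measurable [set t | f t <= g t].
Proof.
move=> mf mg.
have H := measurable_fun_ler mf mg measurableT.
by have := H [set true] I; rewrite setTI preimage_true.
Qed.

End measurable_comparison.

(** * Covariance and Chebyshev's inequality *)

Section covariance.
Context d (T : measurableType d) (R : realType) (P : probability T R).

Lemma covariance_independent d1 d2 (T1 : measurableType d1)
    (T2 : measurableType d2) (Z : {mfun T >-> T1}) (X : {mfun T >-> T2})
    (f : T1 -> R) (g : T2 -> R) :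
  independent_pair P Z X ->
  measurable_fun setT f -> measurable_fun setT g ->
  (f \o Z : T -> R) \in Lfun P 2%:E -> (g \o X : T -> R) \in Lfun P 2%:E ->
  covariance P (f \o Z) (g \o X) = 0%E.
Proof.
move=> ZX mf mg fZ2 gX2.
have Pfin : P setT \is a fin_num := fin_num_measure P _ measurableT.
have fZ1 := Lfun_subset12 Pfin fZ2.
have gX1 := Lfun_subset12 Pfin gX2.
have fgZ1 := Lfun2_mul_Lfun1 fZ2 gX2.
rewrite covarianceE//.
have -> : ('E_P[((f \o Z) * (g \o X))%R] = 'E_P[f \o Z] * 'E_P[g \o X])%E.
  rewrite unlock; apply: (integral_mul_independent ZX mf mg).
  - exact/Lfun1_integrable.
  - exact/Lfun1_integrable.
  - exact/Lfun1_integrable.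
by rewrite subee// fin_numM ?expectation_fin_num.
Qed.

(** Membership in L^2 is proved along with the formula, since the induction
    needs it to split the variance. *)
Lemma variance_sum_independent (I : finType) (X : I -> {RV P >-> R})
    (s : seq I) : mutually_independent X -> uniq s ->
  (forall i, (X i : T -> R) \in Lfun P 2%:E) ->
  ((fun t => \sum_(i <- s) X i t) : T -> R) \in Lfun P 2%:E /\
  'V_P[fun t => (\sum_(i <- s) X i t)%R] = (\sum_(i <- s) 'V_P[X i])%E.
Proof.
move=> indepX + X2; elim: s => [|i s IH] /=.
  move=> _; have -> : (fun t => \sum_(i <- [::]) X i t) = cst 0.
    by apply/funext => t; rewrite big_nil.
  by rewrite big_nil variance_cst Lfun_cst.
move=> /andP[si /IH[S2 VS]].
pose J := [set j in s].
have iJ : i \notin J by rewrite inE.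
pose S (t : T) := \sum_(j <- s) X j t.
have -> : (fun t => \sum_(j <- i :: s) X j t) = S \+ X i.
  by apply/funext => t; rewrite big_cons addrC.
split; first by rewrite rpredD ?lee1n.
have mS : measurable_fun (setT : set (past X J)) S.
  rewrite (_ : S = fun z : past X J =>
      \sum_(j <- s) (if j \in s then X j z else 0)); last first.
    by apply/funext => t; apply: eq_big_seq => j ->.
  apply: measurable_sum => j; have [js|//] := boolP (j \in s).
  by apply: measurable_past; rewrite inE.
have XS : covariance P (S \o to_past X J) (idfun \o X i) = 0%E.
  apply: (covariance_independent (past_independent indepX iJ) mS).
  - exact: measurable_id.
  - exact: S2.
  - exact: X2.
rewrite varianceD// XS VS mule0 adde0 big_cons addeC; congr (_ + _)%E.
Qed.

Lemma chebyshev_mean (n : nat) (m v D : R) (Y : 'I_n -> {RV P >-> R}) :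
  (0 < n)%N -> mutually_independent Y ->
  (forall i, (Y i : T -> R) \in Lfun P 2%:E) ->
  (forall i, 'E_P[Y i] = m%:E)%E -> (forall i, 'V_P[Y i] = v%:E)%E ->
  0 < D ->
  (P [set t | (D < `|m - n%:R^-1 * \sum_(i < n) Y i t|)%R] <=
   (v / (n%:R * D ^+ 2))%:E)%E.
Proof.
move=> n0 indepY Y2 EY VY D0.
have Pfin : P setT \is a fin_num := fin_num_measure P _ measurableT.
have n0R : n%:R != 0 :> R by rewrite pnatr_eq0 -lt0n.
have := variance_sum_independent indepY (enum_uniq 'I_n) Y2.
under eq_bigr do rewrite VY.
rewrite sumEFin big_enum/= sumr_const card_ord => -[S2 VS].
pose S (t : T) := \sum_(i <- enum 'I_n) Y i t.
have mS : measurable_fun setT S by exact: measurable_sum.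
pose M (t : T) := S t * n%:R^-1.
have mM : measurable_fun setT M by exact: measurable_funM.
pose Mrv : {RV P >-> R} := HB.pack M (isMeasurableFun.Build _ _ _ _ M mM).
have M2 : (M : T -> R) \in Lfun P 2%:E by rewrite Lfun_scale ?ler1n.
have VM : 'V_P[M] = (v / n%:R)%:E.
  rewrite varianceZ// VS -EFinM; congr (_%:E); rewrite -(mulr_natl v).
  by field.
have EM : ('E_P[M] = m%:E)%E.
  rewrite expectationZl; last exact: Lfun_subset12.
  have -> : S = \sum_(f <- [seq (Y i : T -> R) | i <- enum 'I_n]) f.
    by apply/funext => t; rewrite big_map fct_sumE.
  rewrite expectation_sum; last first.
    by move=> _ /mapP[i _ ->]; exact: Lfun_subset12.
  rewrite big_map (eq_bigr (fun=> m%:E)) // sumEFin big_enum/= sumr_const.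
  by rewrite card_ord -EFinM -(mulr_natl m) mulKf.
have := @chebyshev _ _ _ P Mrv D D0.
rewrite [X in fine X]EM [X in (_ <= _ * X)%E]VM => H.
apply: (le_trans _ (le_trans H _)).
  apply: le_measure; rewrite ?inE.
  - apply: measurable_ltr_set => //; apply: measurableT_comp => //.
    apply: measurable_funB => //; apply: measurable_funM => //.
    exact: measurable_sum.
  - apply: measurable_ler_set => //; apply: measurableT_comp => //.
    by apply: measurable_funB.
  - by move=> t /= /ltW; rewrite distrC mulrC /M /S big_enum.
rewrite -EFinM lee_fin le_eqVlt; apply/orP; left; apply/eqP.
by field; rewrite n0R gt_eqF.
Qed.
End covariance.

(** * The influence function *)

Section influence.
Context (R : realType).
Implicit Types x : R.

Lemma influence_num_gt0 x : 0 < 1 + x + x ^+ 2 / 2.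
Proof. have := sqr_ge0 (1 + x); nra. Qed.

Lemma influence_den_gt0 x : 0 < 1 - x + x ^+ 2 / 2.
Proof. by have := influence_num_gt0 (- x); rewrite sqrrN. Qed.

Lemma influenceE x :
  influence x = 2^-1 * (ln (1 + x + x ^+ 2 / 2) - ln (1 - x + x ^+ 2 / 2)).
Proof.
by rewrite /influence ln_div// posrE ?influence_num_gt0 ?influence_den_gt0.
Qed.

Lemma influenceN x : influence (- x) = - influence x.
Proof. by rewrite !influenceE opprK sqrrN; lra. Qed.

(** [(1 + x + x^2/2) (1 - x + x^2/2) = 1 + x^4/4 >= 1], so half the logarithm of
    the quotient of the two factors is at most the logarithm of the first. *)
Lemma expR_influence_le x : expR (influence x) <= 1 + x + x ^+ 2 / 2.
Proof.
rewrite -[leRHS]lnK ?posrE ?influence_num_gt0// ler_expR influenceE.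
suff : 0 <= ln (1 + x + x ^+ 2 / 2) + ln (1 - x + x ^+ 2 / 2) by lra.
rewrite -lnM ?posrE ?influence_num_gt0 ?influence_den_gt0//.
by apply: ln_ge0; have := sqr_ge0 (x ^+ 2); nra.
Qed.

Lemma measurable_influence : measurable_fun setT (@influence R).
Proof.
rewrite (_ : @influence R = fun x =>
    2^-1 * (ln (1 + x + x ^+ 2 / 2) - ln (1 - x + x ^+ 2 / 2))); last first.
  by apply/funext => x; exact: influenceE.
apply: measurable_funM => //; apply: measurable_funB;
  apply: measurableT_comp => //; apply: measurable_funD => //;
  by [exact: measurable_funD|exact: measurable_funB|
      apply: measurable_funM => //; exact: measurable_funX].
Qed.

End influence.

(** * Affine substitution for Lebesgue measure *)

Section affine.
Context (R : realType).
Local Notation mu := (@lebesgue_measure R).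
Variables (c s : R).
Hypothesis s0 : 0 < s.

Let F : R -> measurableTypeR R := fun u => c + s * u.

Let mF : measurable_fun setT F.
Proof. by apply: measurable_funD => //; exact: measurable_funM. Qed.

Lemma lebesgue_measure_affine (A : set R) : measurable A ->
  (mu A = s%:E * pushforward mu F A)%E.
Proof.
move=> mA.
pose q : {nonneg R} := NngNum (ltW s0).
pose m : {measure set (measurableTypeR R) -> \bar R} :=
  mscale q (pushforward mu F).
rewrite -[RHS]/(m mF A).
apply: (@lebesgue_measure_unique R (m mF)) => // _ [[a b]/=] _ <-.
rewrite -[RHS]/(s%:E * mu (F @^-1` `]a, b]%classic))%E.
rewrite (_ : F @^-1` _ = `](a - c) / s, (b - c) / s]%classic); last first.
  apply/seteqP; split => u; rewrite /= !in_itv/= /F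
    ltr_pdivrMr// ler_pdivlMr//; lra.
rewrite !lebesgue_measure_itv/= !lte_fin ltr_pM2r ?invr_gt0// ltrD2r.
case: ifP => _; last by rewrite mule0.
by rewrite -!EFinD -EFinM; congr (_%:E); field; rewrite gt_eqF.
Qed.

Lemma ge0_integral_affine (f : R -> \bar R) :
  measurable_fun setT f -> (forall x, 0 <= f x)%E ->
  (\int[mu]_u f (c + s * u)%R = s^-1%:E * \int[mu]_x f x)%E.
Proof.
move=> mf f0.
pose nu : {measure set (measurableTypeR R) -> \bar R} := pushforward mu F.
transitivity (\int[nu mF]_x f x)%E.
  by rewrite /nu ge0_integral_pushforward.
pose q : {nonneg R} := NngNum (ltW s0).
transitivity (s^-1%:E * \int[mscale q (nu mF)]_x f x)%E.
  rewrite ge0_integral_mscale// muleA -EFinM mulVf ?gt_eqF//.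
  by rewrite mul1e.
congr (_ * _)%E; apply: eq_measure_integral => A mA _.
exact/esym/lebesgue_measure_affine.
Qed.

End affine.

(** * The exponential score *)

Section moment.
Context d (T : measurableType d) (R : realType) (P : probability T R).

(** The second-order bound on [expR (influence z)] at [z = a (X - th)] only
    involves the first two moments of [X]. It is [(1 + (1 + z)^2) / 2], and the
    square is integrated through the variance of [1 + z]. *)
Lemma integral_expR_influence_le (X : {RV P >-> R}) (m v a th : R) :
  (X : T -> R) \in Lfun P 2%:E -> ('E_P[X] = m%:E)%E -> ('V_P[X] = v%:E)%E ->
  (\int[P]_t (expR (influence (a * (X t - th))))%:E <=
   (expR (a * (m - th) + a ^+ 2 / 2 * (v + (m - th) ^+ 2)))%:E)%E.
Proof.
move=> X2 EX VX.
have Pfin : P setT \is a fin_num := fin_num_measure P _ measurableT.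
have X1 := Lfun_subset12 Pfin X2.
pose c := 1 - a * th.
pose Z : T -> R := cst c \+ a \o* X.
have ZE t : Z t = 1 + a * (X t - th) by rewrite /Z/= /c; ring.
have aX2 : (a \o* X : T -> R) \in Lfun P 2%:E by rewrite Lfun_scale ?ler1n.
have Z2 : Z \in Lfun P 2%:E.
  by rewrite rpredD ?lee1n//= => _; rewrite Lfun_cst.
have mZ : measurable_fun setT Z.
  by apply: measurable_funD => //; apply: measurable_funM.
have EZ : ('E_P[Z] = (c + a * m)%:E)%E.
  rewrite expectationD ?Lfun_cst ?Lfun_scale//= expectation_cst expectationZl//.
  by rewrite EX.
have VZ : ('V_P[Z] = (a ^+ 2 * v)%:E)%E.
  by rewrite varianceD_cst_l// varianceZ// VX.
have EZ2 : ('E_P[Z ^+ 2] = (a ^+ 2 * v + (c + a * m) ^+ 2)%:E)%E.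
  have := varianceE Z2; rewrite VZ EZ => /esym/eqP.
  rewrite -EFin_expe sube_eq//; first by move=> /eqP ->.
  exact: (expectation_fin_num (Lfun2_mul_Lfun1 Z2 Z2)).
apply: (@le_trans _ _ (\int[P]_t (2^-1 * (1 + (Z t) ^+ 2))%:E)%E).
  apply: ge0_le_integral => //.
  - apply/measurable_EFinP; apply: measurableT_comp => //.
    apply: (measurableT_comp (@measurable_influence R)).
    by apply: measurable_funM => //; apply: measurable_funB.
  - apply/measurable_EFinP; apply: measurable_funM => //.
    by apply: measurable_funD => //; exact: measurable_funX.
  - move=> t _; rewrite lee_fin ZE (le_trans (expR_influence_le _))//.
    by rewrite le_eqVlt; apply/orP; left; apply/eqP; field.
under eq_integral do rewrite EFinM EFinD.
have mZ2 : measurable_fun setT (fun t => (Z t ^+ 2)%:E).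
  by apply/measurable_EFinP; exact: measurable_funX.
have Z2_ge0 t : (0 <= (Z t ^+ 2)%:E)%E by rewrite lee_fin sqr_ge0.
rewrite ge0_integralZl//; last 2 first.
- exact: emeasurable_funD.
- by move=> t _; rewrite adde_ge0.
rewrite ge0_integralD//.
rewrite integral_cst//= probability_setT mule1.
have -> : (\int[P]_t (Z t ^+ 2)%:E = (a ^+ 2 * v + (c + a * m) ^+ 2)%:E)%E.
  by rewrite -EZ2 unlock.
rewrite -EFinD -EFinM lee_fin.
apply: le_trans (expR_ge1Dx _); rewrite /c.
by rewrite le_eqVlt; apply/orP; left; apply/eqP; field.
Qed.

(** The exponential of the sum of the influences, divided by an upper bound of its
    expectation when the sample is independent with mean [m] and variance at most
    [v0]. The sign of [a] selects the side of the deviation. *)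
Definition exp_score (n : nat) (m v0 a : R) (y : 'I_n -> R) (th : R) : R :=
  expR (\sum_(i < n) influence (a * (y i - th)) -
        n%:R * (a * (m - th) + a ^+ 2 / 2 * (v0 + (m - th) ^+ 2))).

Lemma integral_exp_score_le1 (n : nat) (m v v0 a : R)
    (Y : 'I_n -> {RV P >-> R}) (th : R) :
  mutually_independent Y ->
  (forall i, (Y i : T -> R) \in Lfun P 2%:E) ->
  (forall i, 'E_P[Y i] = m%:E)%E -> (forall i, 'V_P[Y i] = v%:E)%E ->
  v <= v0 ->
  (\int[P]_t (exp_score m v0 a (Y ^~ t) th)%:E <= 1)%E.
Proof.
move=> indepY Y2 EY VY vv0.
pose K := a * (m - th) + a ^+ 2 / 2 * (v0 + (m - th) ^+ 2).
have mf : measurable_fun setT (fun r : R => expR (influence (a * (r - th)))).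
  apply: measurableT_comp => //.
  apply: (measurableT_comp (@measurable_influence R)).
  by apply: measurable_funM => //; apply: measurable_funB.
have E t : (exp_score m v0 a (Y ^~ t) th)%:E =
    ((expR (- (n%:R * K)))%:E *
    (\prod_(i <- enum 'I_n) expR (influence (a * (Y i t - th))))%:E)%E.
  rewrite -EFinM; congr (_%:E).
  by rewrite /exp_score addrC expRD big_enum expR_sum.
under eq_integral do rewrite E.
rewrite ge0_integralZl//; last 2 first.
- apply/measurable_EFinP; apply: measurable_prod => i _.
  exact: (measurableT_comp mf).
- by move=> t _; rewrite lee_fin prodr_ge0// => i _; exact: expR_ge0.
rewrite (ge0_integral_prod_independent indepY
  (f := fun i r => expR (influence (a * (r - th)))))?enum_uniq//.
apply: (@le_trans _ _ ((expR (- (n%:R * K)))%:E *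
    \prod_(i <- enum 'I_n) (expR K)%:E)%E).
  apply: lee_wpmul2l; first by rewrite lee_fin expR_ge0.
  elim: (enum 'I_n) => [|i s IH]; first by rewrite !big_nil.
  rewrite !big_cons lee_pmul//.
  - by apply: integral_ge0 => t _; rewrite lee_fin expR_ge0.
  - apply: prode_ge0 => j _.
    by apply: integral_ge0 => t _; rewrite lee_fin expR_ge0.
  - apply: (le_trans (integral_expR_influence_le _ _ (Y2 i) (EY i) (VY i))).
    rewrite lee_fin ler_expR lerD2l ler_wpM2l// ?lerD2r//.
    by rewrite divr_ge0// sqr_ge0.
rewrite prodEFin -EFinM lee_fin big_enum/= prodr_const card_ord -expRM_natl.
by rewrite -expRD addNr expR0.
Qed.

End moment.

(** * One step from a uniformly perturbed centre *)

Section step.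
Context d (T : measurableType d) (R : realType) (P : probability T R).

Lemma measurable_influence_sum d' (T' : measurableType d') (n : nat)
    (y : 'I_n -> T' -> R) (a : R) (th : T' -> R) :
  (forall i, measurable_fun setT (y i)) -> measurable_fun setT th ->
  measurable_fun setT (fun p => \sum_(i < n) influence (a * (y i p - th p))).
Proof.
move=> my mth; apply: measurable_sum => i.
apply: (measurableT_comp (@measurable_influence R)).
by apply: measurable_funM => //; apply: measurable_funB.
Qed.

Lemma measurable_theta_hat d' (T' : measurableType d') (n : nat)
    (y : 'I_n -> T' -> R) (al : R) (th : T' -> R) :
  (forall i, measurable_fun setT (y i)) -> measurable_fun setT th ->
  measurable_fun setT (fun p => theta_hat (y ^~ p) al (th p)).
Proof.
move=> my mth; apply: measurable_funD => //; apply: measurable_funM => //.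
exact: measurable_influence_sum.
Qed.

Lemma measurable_exp_score d' (T' : measurableType d') (n : nat) (m v0 a : R)
    (y : 'I_n -> T' -> R) (th : T' -> R) :
  (forall i, measurable_fun setT (y i)) -> measurable_fun setT th ->
  measurable_fun setT (fun p => exp_score m v0 a (y ^~ p) (th p)).
Proof.
move=> my mth; apply: measurableT_comp => //; apply: measurable_funB.
  exact: measurable_influence_sum.
apply: measurable_funM => //; apply: measurable_funD.
  by apply: measurable_funM => //; exact: measurable_funB.
apply: measurable_funM => //; apply: measurable_funD => //.
by apply: measurable_funX; exact: measurable_funB.
Qed.

Lemma exp_score_ge0 n m v0 a (y : 'I_n -> R) th :
  0 <= exp_score m v0 a y th.
Proof. exact: expR_ge0. Qed.

(** Since [influence] is odd, [sg = 1] and [sg = -1] treat deviations to the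
    right and to the left alike. *)
Lemma exp_score_ge_of_deviation (n : nat) (m v0 al sg r dl th : R)
    (y : 'I_n -> R) :
  (0 < n)%N -> 0 < al -> sg ^+ 2 = 1 -> `|m - th| <= r ->
  dl < sg * (theta_hat y al th - m) ->
  expR (n%:R * (al * dl - al ^+ 2 / 2 * (v0 + r ^+ 2))) <=
  exp_score m v0 (sg * al) y th.
Proof.
move=> n0 al0 sg1 mth dev.
have n0R : 0 < n%:R :> R by rewrite ltr0n.
have -> : exp_score m v0 (sg * al) y th = expR (n%:R * al *
    (sg * (theta_hat y al th - m)) - n%:R * (al ^+ 2 / 2 * (v0 + (m - th) ^+ 2))).
  rewrite /exp_score /theta_hat exprMn sg1 mul1r; congr expR.
  have sgE : sg = 1 \/ sg = -1.
    by move/eqP : sg1; rewrite sqrf_eq1 => /orP[] /eqP; [left|right].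
  have -> : \sum_(i < n) influence (sg * al * (y i - th)) =
      sg * \sum_(i < n) influence (al * (y i - th)).
    rewrite mulr_sumr; apply: eq_bigr => i _.
    by case: sgE => ->; rewrite ?mul1r// !mulN1r mulNr influenceN.
  by field; rewrite !gt_eqF.
rewrite ler_expR mulrBr lerB//.
  by rewrite -[leRHS]mulrA ler_pM2l// ler_pM2l// ltW.
rewrite ler_pM2l// ler_wpM2l ?divr_ge0 ?sqr_ge0// lerD2l.
by rewrite -[leLHS]real_normK ?num_real// lerXn2r// nnegrE// (le_trans _ mth).
Qed.

Context d1 (T1 : measurableType d1) (Z : {mfun T >-> T1}) (X : {RV P >-> R}).
Variables (n : nat) (m v0 al dl D s sg : R).
Variables (y : 'I_n -> T1 -> R) (th : T1 -> R).

(** The centre [th Z + s X] is data dependent, but on [|m - th Z| <= D] the law of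
    this centre given [Z] has a density at most [1 / (2 s)], with support in the
    fixed interval [[m - (D + s), m + (D + s)]]. Integrating the score over this
    interval, of length [2 (D + s)], with respect to Lebesgue measure first and
    exchanging integrals, only fixed centres remain, for which the score has
    mean at most 1. *)
Lemma perturbed_deviation_le : (0 < n)%N -> 0 < al -> sg ^+ 2 = 1 ->
  0 <= D -> 0 < s ->
  (forall i, measurable_fun setT (y i)) -> measurable_fun setT th ->
  independent_pair P Z X -> uniform_N11 X ->
  (forall h, (\int[P]_t (exp_score m v0 (sg * al) (y ^~ (Z t)) h)%:E <= 1)%E) ->
  (P [set t | ((`|m - th (Z t)| <= D) && (dl < sg *
        (theta_hat (y ^~ (Z t)) al (th (Z t) + s * X t) - m)))%R] <=
   (expR (- (n%:R * (al * dl - al ^+ 2 / 2 * (v0 + (D + s) ^+ 2)))) *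
    ((D + s) / s))%:E)%E.
Proof.
move=> n0 al0 sg1 D0 s0 my mth ZX unifX score1.
set r := D + s.
have r0 : 0 <= r by rewrite addr_ge0// ltW.
set c := expR (- _).
(* Lebesgue measure lives on [measurableTypeR R], whose measurable sets are
   those of [R] but whose display differs; the law of [X] is moved there. *)
pose GR := measurableTypeR R.
have mX : measurable_fun setT (X : T -> GR).
  by move=> mT A mA; exact: (measurable_funP X mT A mA).
pose X' : {mfun T >-> GR} :=
  HB.pack (X : T -> GR) (isMeasurableFun.Build _ _ T GR X mX).
have ZX' : independent_pair P Z X' by exact: ZX.
pose B : set (T1 * GR) := [set p | (`|m - th p.1| <= D) && (dl < sg *
        (theta_hat (y ^~ p.1) al (th p.1 + s * p.2) - m))].
have mth1 : measurable_fun setT (fun p : T1 * GR => th p.1).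
  exact: measurableT_comp.
have mB : measurable B.
  rewrite (_ : B = [set p | `|m - th p.1| <= D] `&` [set p | dl < sg *
        (theta_hat (y ^~ p.1) al (th p.1 + s * p.2) - m)]); last first.
    by apply/seteqP; split => p /= /andP.
  apply: measurableI.
    apply: measurable_ler_set => //; apply: measurableT_comp => //.
    exact: measurable_funB.
  apply: measurable_ltr_set => //; apply: measurable_funM => //.
  apply: measurable_funB => //.
  apply: (@measurable_theta_hat _ _ n (fun i (p : T1 * GR) => y i p.1)).
    by move=> i; exact: measurableT_comp.
  by apply: measurable_funD => //; exact: measurable_funM.
have mIB : measurable_fun setT (fun p : T1 * GR => (\1_B p)%:E : \bar R).
  by apply/measurable_EFinP; exact: measurable_indic.
have IB0 (p : T1 * GR) : (0 <= (\1_B p)%:E :> \bar R)%E by rewrite lee_fin.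
pose Iv := `[m - r, m + r]%classic : set R.
pose h (p : T1 * GR) :=
  (exp_score m v0 (sg * al) (y ^~ p.1) p.2 * \1_Iv p.2)%:E.
have mh : measurable_fun setT h.
  apply/measurable_EFinP; apply: measurable_funM.
    apply: (@measurable_exp_score _ _ n m v0 (sg * al)
      (fun i (p : T1 * GR) => y i p.1)) => //.
    by move=> i; exact: measurableT_comp.
  apply: (measurableT_comp _ measurable_snd).
  by apply: measurable_indic; exact: measurable_itv.
have h0 p : (0 <= h p)%E by rewrite lee_fin mulr_ge0// exp_score_ge0.
have c0 : 0 <= c by exact: expR_ge0.
(* Markov's inequality, before integration: on the bad set the score is at
   least [c^-1], and the centre lies in [Iv]. *)
have Bh z u : -1 <= u <= 1 ->
    ((\1_B (z, u))%:E <= c%:E * h (z, (th z + s * u)%R))%E.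
  move=> u1; rewrite indicE; have [|_] := boolP (_ \in B); last first.
    by rewrite mule_ge0.
  rewrite inE => /andP[/= mz dev].
  have mr : `|m - (th z + s * u)| <= r.
    have : `|s * u| <= s.
      by rewrite normrM gtr0_norm// ger_pMr// ler_norml.
    move: mz; rewrite !ler_norml /r => /andP[? ?] /andP[? ?].
    by apply/andP; split; lra.
  rewrite /h/= indicE mem_set; last first.
    rewrite /Iv/= in_itv/=; move: mr; rewrite ler_norml => /andP[? ?].
    by apply/andP; split; lra.
  rewrite mulr1 -EFinM lee_fin /c expRN ler_pdivlMl ?expR_gt0// mulr1.
  exact: exp_score_ge_of_deviation.
have EP : (P [set t | ((`|m - th (Z t)| <= D) && (dl < sg *
        (theta_hat (y ^~ (Z t)) al (th (Z t) + s * X t) - m)))%R] =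
    \int[distribution P Z]_z \int[distribution P X']_u (\1_B (z, u))%:E)%E.
  rewrite -(ge0_integral_joint ZX' mIB IB0).
  rewrite -[in LHS](setIT [set t | _]) -integral_indic//.
  rewrite -[X in measurable X]setTI.
  exact: (measurable_joint Z X' measurableT mB).
rewrite EP.
(* [2^-1] is the density of the uniform law, [s^-1] comes from the substitution
   [x = th z + s * u]. *)
apply: (@le_trans _ _ (\int[distribution P Z]_z
   ((2^-1 * s^-1 * c)%:E * \int[lebesgue_measure]_x h (z, x)))%E).
  apply: ge0_le_integral => //.
  - by move=> z _; apply: integral_ge0.
  - exact: (measurable_fun_fubini_tonelli_F _ mIB IB0).
  - by apply: measurable_funeM; exact: (measurable_fun_fubini_tonelli_F _ mh h0).
  - move=> z _.
    have mz : measurable_fun setT (fun u : GR => (\1_B (z, u))%:E : \bar R).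
      exact: measurableT_comp mIB (pair1_measurable z).
    have mhz : measurable_fun setT (fun u : GR => h (z, u)).
      exact: measurableT_comp mh (pair1_measurable z).
    have mhz' : measurable_fun setT (fun u : GR => h (z, (th z + s * u)%R)).
      apply: (measurableT_comp mhz).
      by apply: measurable_funD => //; exact: measurable_funM.
    rewrite [X in (X <= _)%E](eq_measure_integral
      (uniform_prob (ltrN11 R))); last first.
      by move=> A mA _; exact: unifX.
    rewrite integral_uniform//.
    rewrite opprK -[1 + 1]/(2%:R) -mulrA EFinM -muleA lee_pmul2l ?lte_fin//.
    apply: (@le_trans _ _ (\int[lebesgue_measure]_u
        (c%:E * h (z, (th z + s * u)%R)))%E).
      apply: (@le_trans _ _ (\int[lebesgue_measure]_(u in `[(-1)%R, 1%R])
          (c%:E * h (z, (th z + s * u)%R)))%E).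
        apply: ge0_le_integral => //.
        + exact: measurable_funTS.
        + by apply: measurable_funeM; exact: measurable_funTS.
        + by move=> u /=; rewrite in_itv/=; exact: Bh.
      apply: ge0_subset_integral => //.
      + exact: measurable_funeM.
      + by move=> u _; rewrite mule_ge0.
    rewrite ge0_integralZl//.
    rewrite (@ge0_integral_affine R (th z) s s0 (fun x => h (z, x)))//.
    by rewrite muleA -EFinM (mulrC c).
have mF := measurable_fun_fubini_tonelli_F (m2 := @lebesgue_measure R) _ mh h0.
rewrite ge0_integralZl//; last 2 first.
- by move=> z _; apply: integral_ge0.
- by rewrite lee_fin !mulr_ge0// invr_ge0 ltW.
rewrite (fubini_tonelli h)//.
apply: (@le_trans _ _ ((2^-1 * s^-1 * c)%:E *
    \int[lebesgue_measure]_x (\1_Iv x)%:E)%E).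
  apply: lee_wpmul2l; first by rewrite lee_fin !mulr_ge0// invr_ge0 ltW.
  apply: ge0_le_integral => //.
  - by move=> x _; apply: integral_ge0.
  - exact: (measurable_fun_fubini_tonelli_G _ mh h0).
  - by apply/measurable_EFinP; apply: measurable_indic; exact: measurable_itv.
  - move=> x _.
    have mhx : measurable_fun setT (fun z => h (z, x)).
      exact: measurableT_comp mh (pair2_measurable x).
    rewrite ge0_integral_distribution//=.
    rewrite /h/= indicE; case: (x \in Iv); last first.
      by under eq_integral do rewrite mulr0; rewrite integral0.
    by under eq_integral do rewrite mulr1; exact: score1.
rewrite integral_indic//; last exact: measurable_itv.
rewrite setIT /Iv/= lebesgue_measure_itv/= lte_fin.
case: ifPn => [_|]; last first.
  by rewrite mule0 lee_fin mulr_ge0// divr_ge0// ltW.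
rewrite -EFinD -EFinM lee_fin le_eqVlt; apply/orP; left; apply/eqP.
by field; rewrite gt_eqF.
Qed.

End step.

(** * The levels of the iteration *)

Section levels.
Context (R : realType) (n k : nat) (v0 : R) (x eps : nat -> R).
Hypotheses (n_gt0 : (0 < n)%N) (v0_gt0 : 0 < v0)
  (x_gt0 : forall i, (2 <= i <= k)%N -> 0 < x i)
  (eps_01 : forall i, (1 <= i <= k)%N -> 0 < eps i < 1).
Local Notation delta := (delta_ n v0 x eps).
Local Notation alpha := (alpha_ n v0 x eps).

Let n0 : 0 < n%:R :> R. Proof. by rewrite ltr0n. Qed.

Lemma log_budget_gt0 i : (2 <= i <= k)%N -> 0 < ln (eps i)^-1 + gamma_ x i.
Proof.
move=> ik; have /andP[e0 e1] : 0 < eps i < 1.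
  by apply: eps_01; case/andP: ik => /ltnW -> ->.
rewrite ltr_wpDl//; first by rewrite ln_ge0// invf_ge1// ltW.
by rewrite ln_gt0// ltrDl invr_gt0 x_gt0.
Qed.

Lemma delta_gt0 i : (1 <= i <= k)%N -> 0 < delta i.
Proof.
case: i => [//|[|i]] ik /=.
  have /andP[e0 _] := eps_01 ik.
  by rewrite sqrtr_gt0 divr_gt0// !mulr_gt0.
rewrite sqrtr_gt0 divr_gt0// mulr_gt0//; last exact: log_budget_gt0.
by rewrite mulr_gt0// ltr_wpDr// mulr_ge0 ?sqr_ge0.
Qed.

Lemma alpha_gt0 i : (2 <= i <= k)%N -> 0 < alpha i.
Proof.
move=> ik; rewrite sqrtr_gt0 divr_gt0// mulr_gt0//; first exact: log_budget_gt0.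
by rewrite ltr_wpDr// mulr_ge0 ?sqr_ge0.
Qed.

(** With [L] the right-hand side and [S = v0 + (D + s)^2], the levels satisfy
    [alpha^2 = 2 L / (n S)] and [delta = alpha S], so the exponent is
    [n (alpha^2 S - alpha^2 S / 2) = L]. *)
Lemma step_exponentE i : (2 <= i.+1 <= k)%N ->
  n%:R * (alpha i.+1 * delta i.+1 - alpha i.+1 ^+ 2 / 2 *
    (v0 + (delta i + x i.+1 * delta i) ^+ 2)) = ln (eps i.+1)^-1 + gamma_ x i.+1.
Proof.
case: i => [//|i] ik.
have L0 := log_budget_gt0 ik.
set L := ln _ + _ in L0 *.
have -> : v0 + (delta i.+1 + x i.+2 * delta i.+1) ^+ 2 =
    v0 + (1 + x i.+2) ^+ 2 * delta i.+1 ^+ 2 by ring.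
set S := v0 + _.
have S0 : 0 < S by rewrite ltr_wpDr// mulr_ge0 ?sqr_ge0.
have aE : alpha i.+2 ^+ 2 = 2 * L / (n%:R * S).
  by rewrite sqr_sqrtr// divr_ge0// ?mulr_ge0// ltW// mulr_gt0.
have dE : delta i.+2 = alpha i.+2 * S.
  have a0 := ltW (alpha_gt0 ik).
  rewrite -[RHS]ger0_norm ?mulr_ge0// ?(ltW S0)// -sqrtr_sqr exprMn aE.
  rewrite [LHS]/=; congr Num.sqrt; rewrite -/S -/L.
  by field; rewrite !gt_eqF.
by rewrite dE mulrA -expr2 aE; field; rewrite !gt_eqF.
Qed.

(** The term [gamma_ x] in the exponent cancels the factor
    [(D + s) / s = 1 + 1 / x] by which the perturbation inflates the risk. *)
Lemma step_riskE i : (2 <= i.+1 <= k)%N ->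
  expR (- (n%:R * (alpha i.+1 * delta i.+1 - alpha i.+1 ^+ 2 / 2 *
    (v0 + (delta i + x i.+1 * delta i) ^+ 2)))) *
  ((delta i + x i.+1 * delta i) / (x i.+1 * delta i)) = eps i.+1.
Proof.
move=> ik; rewrite step_exponentE//.
have x0 := x_gt0 ik.
have /andP[e0 _] : 0 < eps i.+1 < 1.
  by apply: eps_01; case/andP: ik => /ltnW -> ->.
have d0 : 0 < delta i.
  by apply: delta_gt0; case/andP: ik => ? /ltnW ->; rewrite andbT.
have y0 : 0 < 1 + (x i.+1)^-1 by rewrite addr_gt0// invr_gt0.
rewrite opprD expRD lnV ?posrE// opprK lnK ?posrE// expRN lnK ?posrE//.
by field; rewrite (gt_eqF d0) (gt_eqF x0) gt_eqF// addr_gt0.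
Qed.

Lemma measurable_theta d (T : measurableType d) (y : 'I_n -> T -> R)
    (u : nat -> T -> R) (i : nat) :
  (forall l, measurable_fun setT (y l)) ->
  (forall j, (2 <= j <= i)%N -> measurable_fun setT (u j)) ->
  measurable_fun setT (fun t => theta_ v0 x eps (y ^~ t) (u ^~ t) i).
Proof.
move=> my; elim: i => [|[|i] IH] mu.
- exact: measurable_cst.
- by apply: measurable_funM => //; exact: measurable_sum.
- apply: measurable_theta_hat => //; apply: measurable_funD.
    by apply: IH => j /andP[j2 ji]; apply: mu; rewrite j2 leqW.
  by apply: measurable_funM => //; apply: mu; rewrite leqnn.
Qed.

End levels.

(** * The iterated estimator *)

Theorem proposition3p1 (d : measure_display) (T : measurableType d)
    (R : realType) (P : probability T R) (n k : nat) (m v v0 : R)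
    (x eps : nat -> R) (Y : 'I_n -> {RV P >-> R}) (U : nat -> {RV P >-> R})
    (n_gt0 : (0 < n)%N) (k_ge1 : (1 <= k)%N)
    (Y_law : forall i j : 'I_n, same_law (Y i) (Y j))
    (Y_L2 : forall i : 'I_n, (Y i : T -> R) \in Lfun P 2%:E)
    (Y_mean : forall i : 'I_n, ('E_P[Y i] = m%:E)%E)
    (Y_var : forall i : 'I_n, ('V_P[Y i] = v%:E)%E)
    (v0_gt0 : 0 < v0) (v_le : v <= v0)
    (x_gt0 : forall i, (2 <= i <= k)%N -> 0 < x i)
    (eps_01 : forall i, (1 <= i <= k)%N -> 0 < eps i < 1)
    (U_unif : forall i, (2 <= i <= k)%N -> uniform_N11 (U i))
    (indep : mutually_independent (@sample_and_uniforms _ _ _ P n k Y U)) :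
  ((1 - 2 * \sum_(1 <= i < k.+1) eps i)%:E <=
   P [set t | (`|m - theta_ v0 x eps (fun i => Y i t) (fun i => U i t) k|
               <= delta_ n v0 x eps k)%R])%E.
Proof.
pose X := @sample_and_uniforms _ _ _ P n k Y U.
pose th i t := theta_ v0 x eps (fun l => Y l t) (fun j => U j t) i.
pose dl := delta_ n v0 x eps.
have n0R : n%:R != 0 :> R by rewrite pnatr_eq0 -lt0n.
have mth i : measurable_fun setT (th i).
  by apply: (@measurable_theta _ _ _ _ _ _ _ (fun l => Y l) (fun j => U j)).
have indepY : mutually_independent Y.
  by apply: (mutually_independent_comp (f := inl) _ indep) => i j [].
pose bad i := [set t | dl i < `|m - th i t|].
have mbad i : measurable (bad i).
  apply: measurable_ltr_set => //; apply: measurableT_comp => //.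
  exact: measurable_funB.
have bad_le i : (1 <= i <= k)%N ->
    (P (bad i) <= (2 * \sum_(1 <= j < i.+1) eps j)%:E)%E.
  elim: i => [//|[_ ik|i IH ik]].
    have dl0 : 0 < dl 1%N by exact: (delta_gt0 n_gt0 v0_gt0 x_gt0 eps_01).
    have /andP[e0 _] := eps_01 _ ik.
    apply: (le_trans (chebyshev_mean n_gt0 indepY Y_L2 Y_mean Y_var dl0)).
    rewrite lee_fin big_nat1 /dl /= sqr_sqrtr; last first.
      by rewrite divr_ge0// ?mulr_ge0// ltW.
    have -> : v / (n%:R * (v0 / (2 * n%:R * eps 1%N))) = 2 * eps 1%N * (v / v0).
      by field; rewrite n0R !gt_eqF.
    by rewrite ger_pMr ?mulr_gt0// ler_pdivrMr// mul1r.
  have i1k : (1 <= i.+1 <= k)%N by case/andP: ik => _ /ltnW.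
  have ik2 : (2 <= i.+2 <= k)%N by case/andP: ik.
  have ltik : (i < k.-1)%N by rewrite -ltnS prednK.
  (* the whole sample and U_2, ..., U_(i + 1) *)
  pose J := [set s : 'I_n + 'I_k.-1 |
    if s is inr j then (j < i)%N else true]%SET.
  pose new : 'I_n + 'I_k.-1 := inr (Ordinal ltik).
  have newJ : new \notin J by rewrite inE /= ltnn.
  have mYJ l : measurable_fun setT (Y l : past X J -> R).
    by apply: (@measurable_past _ _ _ _ _ X J (inl l)); rewrite inE.
  have mthJ : measurable_fun setT (th i.+1 : past X J -> R).
    apply: (@measurable_theta _ _ _ _ _ _ (past X J) (fun l => Y l)
      (fun j => U j)) => // -[|[|j]]// /= ji.
    have jk : (j < k.-1)%N by exact: ltn_trans (ji : (j < i)%N) ltik.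
    by apply: (@measurable_past _ _ _ _ _ X J (inr (Ordinal jk))); rewrite inE.
  have step sg : sg ^+ 2 = 1 ->
      (P [set t | (`|m - th i.+1 t| <= dl i.+1) &&
          (dl i.+2 < sg * (th i.+2 t - m))]%R <= (eps i.+2)%:E)%E.
    move=> sg1.
    have dl0 : 0 < dl i.+1 by exact: (delta_gt0 n_gt0 v0_gt0 x_gt0 eps_01).
    have x0 := x_gt0 _ ik2.
    rewrite -(step_riskE n_gt0 v0_gt0 x_gt0 eps_01 ik2).
    apply: (@perturbed_deviation_le _ _ _ P _ _ (to_past X J) (U i.+2) n m v0
      (alpha_ n v0 x eps i.+2) (dl i.+2) (dl i.+1) (x i.+2 * dl i.+1) sg
      (fun l => Y l) (th i.+1)) => //.
    - exact: (alpha_gt0 n_gt0 v0_gt0 x_gt0 eps_01).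
    - exact: ltW.
    - exact: mulr_gt0.
    - exact: (past_independent indep newJ).
    - exact: U_unif.
    - move=> h.
      exact: (integral_exp_score_le1 _ _ indepY Y_L2 Y_mean Y_var v_le).
  pose A sg := [set t | (`|m - th i.+1 t| <= dl i.+1) &&
          (dl i.+2 < sg * (th i.+2 t - m))].
  have mA sg : measurable (A sg).
    rewrite (_ : A sg = [set t | `|m - th i.+1 t| <= dl i.+1] `&`
        [set t | dl i.+2 < sg * (th i.+2 t - m)]); last first.
      by apply/seteqP; split => t /= /andP.
    apply: measurableI.
      apply: measurable_ler_set => //; apply: measurableT_comp => //.
      exact: measurable_funB.
    apply: measurable_ltr_set => //; apply: measurable_funM => //.
    exact: measurable_funB.
  have badS : bad i.+2 `<=` bad i.+1 `|` (A 1 `|` A (-1)).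
    move=> t /= badt.
    have [gt|gt] := ltP (dl i.+1) `|m - th i.+1 t|; first by left.
    right; move: badt; rewrite /bad /A/= gt !mul1r mulN1r opprB /=.
    by rewrite lter_normr opprB => /orP[] ?; [right|left].
  apply: (@le_trans _ _ (P (bad i.+1) + (P (A 1%R) + P (A (-1)%R)))%E).
    apply: (@le_trans _ _ (P (bad i.+1 `|` (A 1%R `|` A (-1)%R)))).
      by apply: le_measure; rewrite ?inE//; repeat apply: measurableU.
    apply: (le_trans (measureU2 _ _ _)) => //; first exact: measurableU.
    by rewrite leeD2l// measureU2.
  rewrite big_nat_recr//= mulrDr (mulr_natl (eps _)) mulr2n 2!EFinD.
  apply: leeD; first exact: IH.
  by apply: leeD; apply: step; rewrite ?sqrrN expr1n.
rewrite [X in P X](_ : _ = ~` bad k); last first.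
  by apply/seteqP; split => t /=; rewrite /bad /= leNgt => /negP.
by rewrite probability_setC// EFinB leeB// bad_le// k_ge1 leqnn.
Qed.
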